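(* For every $n\in\omega$, there is no Turing degree low${}_2$ over $\emptyset^{(n)}$ that bounds $\mathsf{STS}(n+2)$.
   Context: $\emptyset^{(n)}$ is the $n$-th jump of $\emptyset$. A set $X$ is low${}_2$ over $Y$ if $(X\oplus Y)''\leq_T Y''$. A degree bounds a principle if every computable instance of the principle has a solution computable in that degree. For $k\geq 1$, a coloring $g:[\omega]^{k+1}\to\omega$ is stable if for every $\sigma\in[\omega]^k$ the limit $\lim_s g(\sigma,s)$ exists. A set $A$ is thin for $g:[\omega]^k\to\omega$ if $g([A]^k)\neq\omega$. $\mathsf{STS}(k)$: every stable coloring $g:[\omega]^k\to\omega$ has an infinite set thin for $g$. *)

(* Defs.v *)
From mathcomp Require Import all_boot.
Set Implicit Arguments. Unset Strict Implicit. Unset Printing Implicit Defensive.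

Definition nset := nat -> Prop.

Inductive code : Type :=
| CZero : code
| CSucc : code
| CProj : nat -> code
| COrc  : code
| CComp : code -> list code -> code
| CPrec : code -> code -> code
| CMu   : code -> code.

Inductive eval (A : nset) : code -> list nat -> nat -> Prop :=
| ev_zero xs : eval A CZero xs 0
| ev_succ xs : eval A CSucc xs (nth 0 xs 0).+1
| ev_proj i xs : eval A (CProj i) xs (nth 0 xs i)
| ev_orc1 xs : A (nth 0 xs 0) -> eval A COrc xs 1
| ev_orc0 xs : ~ A (nth 0 xs 0) -> eval A COrc xs 0
| ev_comp f gs xs ys v :
    evals A gs xs ys -> eval A f ys v -> eval A (CComp f gs) xs v
| ev_prec0 f g xs v : eval A f xs v -> eval A (CPrec f g) (0 :: xs) v
| ev_precS f g x xs w v :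
    eval A (CPrec f g) (x :: xs) w -> eval A g (x :: w :: xs) v ->
    eval A (CPrec f g) (x.+1 :: xs) v
| ev_mu f xs y :
    eval A f (y :: xs) 0 ->
    (forall z, z < y -> exists w, eval A f (z :: xs) w.+1) ->
    eval A (CMu f) xs y
with evals (A : nset) : list code -> list nat -> list nat -> Prop :=
| evs_nil xs : evals A [::] xs [::]
| evs_cons g gs xs v vs :
    eval A g xs v -> evals A gs xs vs -> evals A (g :: gs) xs (v :: vs).

(* Effective (surjective) enumeration of codes via the countable type of
   generic trees. *)
Fixpoint tree_code (t : GenTree.tree nat) : code :=
  match t with
  | GenTree.Leaf i => CProj i
  | GenTree.Node 0 _ => CZero
  | GenTree.Node 1 _ => CSucc
  | GenTree.Node 2 _ => COrc
  | GenTree.Node 3 (t1 :: ts) => CComp (tree_code t1) (map tree_code ts)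
  | GenTree.Node 4 (t1 :: t2 :: _) => CPrec (tree_code t1) (tree_code t2)
  | GenTree.Node 5 (t1 :: _) => CMu (tree_code t1)
  | _ => CZero
  end.

Definition phi (e : nat) : code :=
  tree_code (odflt (GenTree.Leaf 0) (@unpickle (GenTree.tree nat) e)).

Definition chi (X : nset) (n v : nat) : Prop := (X n /\ v = 1) \/ (~ X n /\ v = 0).

Definition turing_le (X Y : nset) : Prop :=
  exists c, forall n, exists v, eval Y c [:: n] v /\ chi X n v.

Definition emptyset : nset := fun _ => False.

Definition join (X Y : nset) : nset :=
  fun n => if odd n then Y n./2 else X n./2.

Definition jump (X : nset) : nset := fun e => exists v, eval X (phi e) [:: e] v.

Definition jumpn (n : nat) : nset := iter n jump emptyset.

Definition low2_over (X Y : nset) : Prop :=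
  turing_le (jump (jump (join X Y))) (jump (jump Y)).

(* [omega]^k : strictly increasing lists of length k. *)
Definition ktuple (k : nat) (s : seq nat) : bool := (size s == k) && sorted ltn s.

(* A coloring [omega]^k -> omega (values off [omega]^k are irrelevant). *)
Definition coloring := seq nat -> nat.

Definition computable_coloring (k : nat) (g : coloring) : Prop :=
  exists c, forall s, ktuple k s -> eval emptyset c s (g s).

Definition stable_coloring (k : nat) (g : coloring) : Prop :=
  forall sigma, ktuple k sigma ->
    exists v N, forall s, N < s -> ktuple k.+1 (rcons sigma s) ->
      g (rcons sigma s) = v.

Definition infinite_set (A : nset) : Prop := forall N, exists x, N < x /\ A x.

Definition thin (k : nat) (g : coloring) (A : nset) : Prop :=
  exists m, forall s, ktuple k s -> (forall x, x \in s -> A x) -> g s <> m.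

(* Main.v *)
Require Import Defs.
From mathcomp Require Import all_boot boolp.
Set Implicit Arguments. Unset Strict Implicit. Unset Printing Implicit Defensive.

(* Put W = D (+) 0^(n).  That [phi i] computes from W an infinite set avoiding
   color m under t |-> phi c (c :: t) is a Pi_2(W) property of (c, (i, m)),
   hence decidable in W'' <=_T 0^(n+2), hence a limit of a function computable
   in 0^(n+1).  Guess from stage x of this limit the least pair (i, m) good for
   c, and let M(c, x) be its m.  By the iterated limit lemma M is an
   (n+1)-fold limit of a computable g(c, x, s_1, ..., s_{n+1}), and the innermost
   limit always exists.  Taking for c an index of g itself (which replaces the
   recursion theorem), the coloring g(c, .) is stable, and any thin set
   computable in D makes some pair good.  For the least good pair (i, m) and
   large x, the (n+1)-fold limit of g(c, x, .) is m, so the infinite set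
   computed by [phi i] contains a tuple of color m, which it was to avoid. *)

(* The scheme generated for [eval] has no induction hypothesis under the
   existential of [ev_mu]. *)
Section EvalInd.
Variables (A : nset) (P : code -> seq nat -> nat -> Prop)
  (Q : seq code -> seq nat -> seq nat -> Prop).
Hypotheses
  (Hzero : forall xs, P CZero xs 0)
  (Hsucc : forall xs, P CSucc xs (nth 0 xs 0).+1)
  (Hproj : forall i xs, P (CProj i) xs (nth 0 xs i))
  (Horc1 : forall xs, A (nth 0 xs 0) -> P COrc xs 1)
  (Horc0 : forall xs, ~ A (nth 0 xs 0) -> P COrc xs 0)
  (Hcomp : forall f gs xs ys v, Q gs xs ys -> P f ys v -> P (CComp f gs) xs v)
  (Hprec0 : forall f g xs v, P f xs v -> P (CPrec f g) (0 :: xs) v)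
  (HprecS : forall f g x xs w v, P (CPrec f g) (x :: xs) w ->
     P g (x :: w :: xs) v -> P (CPrec f g) (x.+1 :: xs) v)
  (Hmu : forall f xs y, P f (y :: xs) 0 ->
     (forall z, z < y -> exists w, P f (z :: xs) w.+1) -> P (CMu f) xs y)
  (Hnil : forall xs, Q [::] xs [::])
  (Hcons : forall g gs xs v vs, P g xs v -> Q gs xs vs ->
     Q (g :: gs) xs (v :: vs)).

Fixpoint eval_mut c xs v (e : eval A c xs v) {struct e} : P c xs v :=
  match e in eval _ c xs v return P c xs v with
  | ev_zero xs => Hzero xs
  | ev_succ xs => Hsucc xs
  | ev_proj i xs => Hproj i xs
  | ev_orc1 xs h => Horc1 h
  | ev_orc0 xs h => Horc0 h
  | ev_comp f gs xs ys v es e => Hcomp (evals_mut es) (eval_mut e)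
  | ev_prec0 f g xs v e => Hprec0 g (eval_mut e)
  | ev_precS f g x xs w v e1 e2 => HprecS (eval_mut e1) (eval_mut e2)
  | ev_mu f xs y e h => Hmu (eval_mut e) (fun z lt =>
      let: ex_intro w ew := h z lt in ex_intro _ w (eval_mut ew))
  end
with evals_mut cs xs vs (e : evals A cs xs vs) {struct e} : Q cs xs vs :=
  match e in evals _ cs xs vs return Q cs xs vs with
  | evs_nil xs => Hnil xs
  | evs_cons g gs xs v vs e es => Hcons (eval_mut e) (evals_mut es)
  end.
End EvalInd.

(** * Total relative computability *)

Definition chin (X : nset) (n : nat) : nat := `[< X n >].

(** Only lists of length [k] are constrained, so that a code can rebuild its whole argument list
    from finitely many projections. *)
Definition Rec (A : nset) (k : nat) (F : seq nat -> nat) : Prop :=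
  exists c, forall xs, size xs = k -> eval A c xs (F xs).

Lemma eval_orc A xs : eval A COrc xs (chin A (nth 0 xs 0)).
Proof.
by rewrite /chin; case: asboolP => h; [apply: ev_orc1 | apply: ev_orc0].
Qed.

Lemma eval_comp1 A f g xs v w :
  eval A g xs v -> eval A f [:: v] w -> eval A (CComp f [:: g]) xs w.
Proof.
by move=> eg; apply: (ev_comp (evs_cons eg (evs_nil _ _))).
Qed.

Lemma evals_projs A m xs :
  evals A [seq CProj j | j <- iota m (size xs - m)] xs (drop m xs).
Proof.
move: {2}(size xs - m) (erefl (size xs - m)) => d.
elim: d m => [|d IHd] m hd; rewrite hd /=.
  by rewrite drop_oversize -?subn_eq0 ?hd //; apply: evs_nil.
have lt_m : m < size xs by rewrite -subn_gt0 hd.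
rewrite (drop_nth 0 lt_m); apply: evs_cons; first exact: ev_proj.
have hd1 : size xs - m.+1 = d by rewrite subnS hd.
by rewrite -hd1; apply: IHd.
Qed.

Section RecClosure.
Variable A : nset.
Implicit Types (k : nat) (F G H : seq nat -> nat).

Lemma rec_ext k F G :
  (forall xs, size xs = k -> F xs = G xs) -> Rec A k F -> Rec A k G.
Proof. by move=> eFG [c hc]; exists c => xs hs; rewrite -eFG //; apply: hc. Qed.

Lemma rec_proj k i : Rec A k (fun xs => nth 0 xs i).
Proof. by exists (CProj i) => xs _; apply: ev_proj. Qed.

Lemma rec_comp k F (js : seq nat) (G : nat -> seq nat -> nat) :
  Rec A (size js) F -> (forall j, Rec A k (G j)) ->
  Rec A k (fun xs => F [seq G j xs | j <- js]).
Proof.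
case=> c hc hG.
suff [ds hds] : exists ds, forall xs, size xs = k ->
    evals A ds xs [seq G j xs | j <- js].
  exists (CComp c ds) => xs hs; apply: ev_comp (hds xs hs) _.
  by apply: hc; rewrite size_map.
elim: js {hc} => [|j js [ds hds]]; first by exists [::] => xs _; apply: evs_nil.
have [d hd] := hG j.
by exists (d :: ds) => xs hs; apply: evs_cons; [apply: hd | apply: hds].
Qed.

Lemma rec_comp1 k (f : nat -> nat) F :
  Rec A 1 (fun ys => f (nth 0 ys 0)) -> Rec A k F -> Rec A k (fun xs => f (F xs)).
Proof. by move=> hf hF; apply: (rec_comp (js := [:: 0]) (G := fun=> F) hf). Qed.

Lemma rec_comp2 k (f : nat -> nat -> nat) F G :
  Rec A 2 (fun ys => f (nth 0 ys 0) (nth 0 ys 1)) -> Rec A k F -> Rec A k G ->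
  Rec A k (fun xs => f (F xs) (G xs)).
Proof.
move=> hf hF hG.
by apply: (rec_comp (js := [:: 0; 1])
  (G := fun j => if j is 0 then F else G) hf) => -[].
Qed.

Lemma rec_cons k F G :
  Rec A k.+1 F -> Rec A k G -> Rec A k (fun xs => F (G xs :: xs)).
Proof.
move=> [c hc] [d hd].
exists (CComp c (d :: [seq CProj j | j <- iota 0 k])) => xs sz_xs.
apply: (@ev_comp _ _ _ _ (G xs :: xs)); last by apply: hc; rewrite /= sz_xs.
apply: evs_cons (hd _ sz_xs) _.
by have := evals_projs A 0 xs; rewrite drop0 subn0 sz_xs.
Qed.

Lemma rec_succ k F : Rec A k F -> Rec A k (fun xs => (F xs).+1).
Proof.
by apply: rec_comp1; exists CSucc => xs _; apply: ev_succ.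
Qed.

Lemma rec_const k n : Rec A k (fun=> n).
Proof.
elim: n => [|n IHn]; first by exists CZero => xs _; apply: ev_zero.
exact: rec_succ IHn.
Qed.

Lemma rec_chin k F : Rec A k F -> Rec A k (fun xs => chin A (F xs)).
Proof. by apply: rec_comp1; exists COrc => xs _; apply: eval_orc. Qed.

Lemma rec_prec k S B N :
  Rec A k.+2 S -> Rec A k B -> Rec A k N ->
  Rec A k (fun xs => nat_rect (fun=> nat) (B xs)
    (fun n r => S (n :: r :: xs)) (N xs)).
Proof.
move=> [s hs] [b hb] [n hn].
exists (CComp (CPrec b s) (n :: [seq CProj j | j <- iota 0 k])) => xs sz_xs.
apply: (@ev_comp _ _ _ _ (N xs :: xs)).
  apply: evs_cons (hn _ sz_xs) _.
  by have := evals_projs A 0 xs; rewrite drop0 subn0 sz_xs.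
elim: (N xs) => [|m IHm] /=; first exact: ev_prec0 (hb _ sz_xs).
by apply: ev_precS IHm _; apply: hs; rewrite /= sz_xs.
Qed.

Lemma rec_drop k m F : Rec A k F -> Rec A (m + k) (fun xs => F (drop m xs)).
Proof.
case=> c hc; exists (CComp c [seq CProj j | j <- iota m k]) => xs sz_xs.
apply: (@ev_comp _ _ _ _ (drop m xs)); last first.
  by apply: hc; rewrite size_drop sz_xs addKn.
by have := evals_projs A m xs; rewrite sz_xs addKn.
Qed.

Lemma rec_iter k S B N :
  Rec A k.+1 S -> Rec A k B -> Rec A k N ->
  Rec A k (fun xs => iter (N xs) (fun r => S (r :: xs)) (B xs)).
Proof.
move=> hS hB hN.
apply: rec_ext (rec_prec (S := fun ys => S (behead ys)) _ hB hN).
  by move=> xs _; elim: (N xs) => //= m ->.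
by apply: rec_ext (rec_drop 1 hS) => -[|x xs] //= _; rewrite drop0.
Qed.

Lemma rec_pred k F : Rec A k F -> Rec A k (fun xs => (F xs).-1).
Proof.
apply: rec_comp1.
apply: rec_ext (rec_prec (S := fun ys => nth 0 ys 0) (rec_proj _ 0)
  (rec_const _ 0) (rec_proj _ 0)).
by move=> xs _; case: (nth 0 xs 0).
Qed.

Lemma rec_add k F G : Rec A k F -> Rec A k G -> Rec A k (fun xs => F xs + G xs).
Proof.
apply: rec_comp2.
apply: rec_ext (rec_iter (S := fun ys => (nth 0 ys 0).+1) (rec_succ (rec_proj _ 0))
  (rec_proj _ 0) (rec_proj _ 1)) => xs _.
by rewrite -[iter _ _ _]/(iter _ succn _) iter_succn.
Qed.

Lemma rec_sub k F G : Rec A k F -> Rec A k G -> Rec A k (fun xs => F xs - G xs).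
Proof.
apply: rec_comp2.
apply: rec_ext (rec_iter (S := fun ys => (nth 0 ys 0).-1) (rec_pred (rec_proj _ 0))
  (rec_proj _ 0) (rec_proj _ 1)) => xs _.
by elim: (nth 0 xs 1) => [|m IH] /=; rewrite ?subn0 // subnS IH.
Qed.

Lemma rec_mul k F G : Rec A k F -> Rec A k G -> Rec A k (fun xs => F xs * G xs).
Proof.
apply: rec_comp2.
apply: rec_ext (rec_iter (S := fun ys => nth 0 ys 1 + nth 0 ys 0)
  (rec_add (rec_proj _ 1) (rec_proj _ 0))
  (rec_const _ 0) (rec_proj _ 1)) => xs _ /=.
by rewrite mulnC; elim: (nth 0 xs 1) => [|m IH] //=; rewrite IH mulSn.
Qed.

(** * Decidable predicates, through [nat_of_bool] *)

Implicit Types p q : seq nat -> bool.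

Lemma rec_neg k p : Rec A k (fun xs => p xs) -> Rec A k (fun xs => ~~ p xs).
Proof.
move=> hp; apply: rec_ext (rec_sub (rec_const k 1) hp) => xs _.
by case: (p xs).
Qed.

Lemma rec_and k p q : Rec A k (fun xs => p xs) -> Rec A k (fun xs => q xs) ->
  Rec A k (fun xs => p xs && q xs).
Proof.
move=> hp hq; apply: rec_ext (rec_mul hp hq) => xs _.
by case: (p xs); case: (q xs).
Qed.

Lemma rec_or k p q : Rec A k (fun xs => p xs) -> Rec A k (fun xs => q xs) ->
  Rec A k (fun xs => p xs || q xs).
Proof.
move=> hp hq; apply: rec_ext (rec_neg (rec_and (rec_neg hp) (rec_neg hq))).
by move=> xs _; case: (p xs); case: (q xs).
Qed.

Lemma rec_leq k F G : Rec A k F -> Rec A k G -> Rec A k (fun xs => F xs <= G xs).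
Proof.
move=> hF hG; apply: rec_ext (rec_sub (rec_const k 1) (rec_sub hF hG)) => xs _.
by rewrite /leq; case: (F xs - G xs).
Qed.

Lemma rec_eq k F G : Rec A k F -> Rec A k G -> Rec A k (fun xs => F xs == G xs).
Proof.
move=> hF hG; apply: rec_ext (rec_and (rec_leq hF hG) (rec_leq hG hF)) => xs _.
by rewrite eqn_leq.
Qed.

Lemma rec_if k p F G :
  Rec A k (fun xs => p xs) -> Rec A k F -> Rec A k G ->
  Rec A k (fun xs => if p xs then F xs else G xs).
Proof.
move=> hp hF hG.
apply: rec_ext (rec_add (rec_mul hp hF) (rec_mul (rec_neg hp) hG)) => xs _.
by case: (p xs); rewrite /= ?mul1n ?mul0n ?addn0.
Qed.

Lemma rec_all k (js : seq nat) (p : nat -> seq nat -> bool) :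
  (forall j, Rec A k (fun xs => p j xs)) ->
  Rec A k (fun xs => all (fun j => p j xs) js).
Proof.
move=> hp; elim: js => [|j js IH] /=; first exact: rec_const.
exact: rec_and.
Qed.

Lemma rec_odd k F : Rec A k F -> Rec A k (fun xs => odd (F xs)).
Proof.
apply: (@rec_comp1 k (fun x => odd x)).
apply: rec_ext (rec_iter (S := fun ys => 1 - nth 0 ys 0)
  (rec_sub (rec_const _ 1) (rec_proj _ 0)) (rec_const _ 0) (rec_proj _ 0)) => xs _.
by elim: (nth 0 xs 0) => [|m IH] //=; rewrite IH; case: (odd m).
Qed.

Lemma rec_half k F : Rec A k F -> Rec A k (fun xs => (F xs)./2).
Proof.
apply: rec_comp1.
apply: rec_ext (rec_prec (S := fun ys => odd (nth 0 ys 0) + nth 0 ys 1)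
  (rec_add (rec_odd (rec_proj _ 0)) (rec_proj _ 1))
  (rec_const _ 0) (rec_proj _ 0)) => xs _.
by elim: (nth 0 xs 0) => [|m IH] //=; rewrite IH uphalf_half.
Qed.

Lemma rec_exp2 k F : Rec A k F -> Rec A k (fun xs => 2 ^ F xs).
Proof.
apply: rec_comp1.
apply: rec_ext (rec_iter (S := fun ys => 2 * nth 0 ys 0)
  (rec_mul (rec_const _ 2) (rec_proj _ 0)) (rec_const _ 1) (rec_proj _ 0)) => xs _.
by elim: (nth 0 xs 0) => [|m IH] //=; rewrite IH expnS.
Qed.

End RecClosure.

(** * Pairing, compatible with [CodeSeq.code] *)

Notation encl := CodeSeq.code.
(** Every positive number is uniquely $2^a(2b+1)$: [pr] is at once a pairing and the cons of coded
    lists, and 0, never a pair, codes the empty list. *)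
Definition pr (a b : nat) : nat := 2 ^ a * b.*2.+1.
Definition p1 (z : nat) : nat := head 0 (CodeSeq.decode z).
Definition p2 (z : nat) : nat := encl (behead (CodeSeq.decode z)).
Arguments pr : simpl never.
Arguments p1 : simpl never.
Arguments p2 : simpl never.

Lemma encl_cons a l : encl (a :: l) = pr a (encl l). Proof. by []. Qed.
Lemma p1_nil : p1 0 = 0. Proof. by []. Qed.
Lemma p2_nil : p2 0 = 0. Proof. by []. Qed.

Lemma p1_pr a b : p1 (pr a b) = a.
Proof. by rewrite /p1 -[b]CodeSeq.decodeK -encl_cons CodeSeq.codeK. Qed.

Lemma p2_pr a b : p2 (pr a b) = b.
Proof. by rewrite /p2 -{1}[b]CodeSeq.decodeK -encl_cons CodeSeq.codeK CodeSeq.decodeK. Qed.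

Lemma pr_gt0 a b : 0 < pr a b.
Proof. by rewrite /pr muln_gt0 expn_gt0. Qed.

Lemma pr_eq0 a b : (pr a b == 0) = false.
Proof. by rewrite eqn0Ngt pr_gt0. Qed.

Lemma pr0 b : pr 0 b = b.*2.+1.
Proof. by rewrite /pr expn0 mul1n. Qed.

Lemma prS a b : pr a.+1 b = (pr a b).*2.
Proof. by rewrite /pr expnS -mulnA mul2n. Qed.

Lemma prK z : 0 < z -> pr (p1 z) (p2 z) = z.
Proof.
by rewrite -{1 4}[z]CodeSeq.decodeK /p1 /p2; case: (CodeSeq.decode z).
Qed.

Lemma ltn_p1 a b : a < pr a b.
Proof. by rewrite /pr (leq_trans (ltn_expl a (isT : 1 < 2))) // leq_pmulr. Qed.

Lemma iter_halve k a b :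
  iter k (fun z => if odd z then z else z./2) (pr a b) = pr (a - k) b.
Proof.
elim: k => [|k IHk]; first by rewrite subn0.
rewrite iterS IHk subnS; case: (a - k) => [|m].
  by rewrite pr0 /= odd_double.
by rewrite prS odd_double doubleK.
Qed.

Lemma rec_pr A k F G : Rec A k F -> Rec A k G -> Rec A k (fun xs => pr (F xs) (G xs)).
Proof.
move=> hF hG.
apply: rec_ext (rec_mul (rec_exp2 hF) (rec_succ (rec_add hG hG))) => xs _.
by rewrite addnn.
Qed.

Lemma rec_halve A k F N : Rec A k F -> Rec A k N -> Rec A k (fun xs =>
  iter (N xs) (fun z => if odd z then z else z./2) (F xs)).
Proof.
move=> hF hN; apply: (rec_iter (S := fun ys => if odd (nth 0 ys 0) then nth 0 ys 0
  else (nth 0 ys 0)./2)) => //.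
by apply: rec_if; [apply: rec_odd | | apply: rec_half]; apply: rec_proj.
Qed.

(** For [z > 0] the exponent [p1 z] is below [z], so [z] halvings, each idle on odd numbers, leave
    the odd part [(p2 z).*2.+1]. *)
Lemma rec_p2 A k F : Rec A k F -> Rec A k (fun xs => p2 (F xs)).
Proof.
apply: rec_comp1.
apply: rec_ext (rec_half (rec_halve (rec_proj A 1 0) (rec_proj A 1 0))) => xs _.
case: (posnP (nth 0 xs 0)) => [->|z_gt0] //.
rewrite -{2 3}(prK z_gt0) p2_pr iter_halve.
have /eqP-> : p1 (nth 0 xs 0) - nth 0 xs 0 == 0.
  by rewrite subn_eq0 -{2}(prK z_gt0) ltnW ?ltn_p1.
by rewrite pr0 /= uphalf_double.
Qed.

(** The exponent of 2 in [z] is the number of [m < z] such that [z] is still even after [m]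
    halvings. *)
Lemma rec_p1 A k F : Rec A k F -> Rec A k (fun xs => p1 (F xs)).
Proof.
apply: rec_comp1.
apply: rec_ext (rec_prec (S := fun ys => nth 0 ys 1 + ~~ odd (iter (nth 0 ys 0)
    (fun z => if odd z then z else z./2) (nth 0 ys 2)))
  _ (rec_const _ 1 0) (rec_proj A 1 0)); last first.
  by apply/rec_add/rec_neg/rec_odd/rec_halve; apply: rec_proj.
move=> xs _; case: (posnP (nth 0 xs 0)) => [->|z_gt0] //=.
rewrite -{1}(prK z_gt0); set a := p1 _; set b := p2 _.
have {z_gt0} : a <= nth 0 xs 0 by rewrite -(prK z_gt0) ltnW ?ltn_p1.
move/minn_idPr => {2}<-.
elim: (nth 0 xs 0) => [|m IHm] /=; first by rewrite min0n.
rewrite {}IHm iter_halve; case: (leqP a m) => h.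
  rewrite (minn_idPr (leqW h)).
  by rewrite (eqP (h : a - m == 0)) pr0 /= odd_double addn0.
rewrite (minn_idPl h).
by move: h; rewrite -subn_gt0; case: (a - m) => // d _; rewrite prS odd_double addn1.
Qed.

Lemma rec_encl A k (js : seq nat) (F : nat -> seq nat -> nat) :
  (forall j, Rec A k (F j)) -> Rec A k (fun xs => encl [seq F j xs | j <- js]).
Proof.
move=> hF; elim: js => [|j js IH] /=; first exact: rec_const.
exact: rec_pr.
Qed.

Ltac rec_hook := fail.
Ltac rec_auto := repeat (cbv beta; first [rec_hook | lazymatch goal with
  | |- Rec _ _ (fun _ => ?n) => exact: rec_const
  | |- Rec _ _ (fun xs => nth 0 xs ?i) => exact: rec_proj
  | |- Rec _ _ (fun xs => nat_of_bool (~~ @?p xs)) => apply: (rec_neg (p := p))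
  | |- Rec _ _ (fun xs => nat_of_bool (@?p xs && @?q xs)) =>
      apply: (rec_and (p := p) (q := q))
  | |- Rec _ _ (fun xs => nat_of_bool (@?p xs || @?q xs)) =>
      apply: (rec_or (p := p) (q := q))
  | |- Rec _ _ (fun xs => nat_of_bool (@?F xs == @?G xs)) =>
      apply: (rec_eq (F := F) (G := G))
  | |- Rec _ _ (fun xs => nat_of_bool (@?F xs <= @?G xs)) =>
      apply: (rec_leq (F := F) (G := G))
  | |- Rec _ _ (fun xs => (@?F xs).+1) => apply: (rec_succ (F := F))
  | |- Rec _ _ (fun xs => (@?F xs).-1) => apply: (rec_pred (F := F))
  | |- Rec _ _ (fun xs => p1 (@?F xs)) => apply: (rec_p1 (F := F))
  | |- Rec _ _ (fun xs => p2 (@?F xs)) => apply: (rec_p2 (F := F))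
  | |- Rec _ _ (fun xs => pr (@?F xs) (@?G xs)) => apply: (rec_pr (F := F) (G := G))
  | |- Rec _ _ (fun xs => @?F xs + @?G xs) => apply: (rec_add (F := F) (G := G))
  | |- Rec _ _ (fun xs => @?F xs - @?G xs) => apply: (rec_sub (F := F) (G := G))
  | |- Rec ?A _ (fun xs => chin ?A (@?F xs)) => apply: (rec_chin (F := F))
  | |- Rec _ _ (fun xs => if _ then _ else _) => apply: rec_if
  end]).

(** * A universal stack machine *)

(** A numbering made for the machine: a tag, then the components, all readable by [p1] and [p2].
    Indices of [phi] are translated into it by [dec]. *)
Fixpoint encc (c : code) : nat :=
  match c with
  | CZero => pr 0 0
  | CSucc => pr 1 0
  | COrc => pr 2 0
  | CComp f gs => pr 3 (pr (encc f) (encl [seq encc g | g <- gs]))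
  | CPrec f g => pr 4 (pr (encc f) (encc g))
  | CMu f => pr 5 (encc f)
  | CProj i => pr 6 i
  end.

(* A state evaluates one code, evaluates a list of codes (from right to left),
   or returns a value; [K] is the stack of pending frames. *)
Definition stE c xs K := pr 0 (pr c (pr xs K)).
Definition stL gs xs K := pr 1 (pr gs (pr xs K)).
Definition stR v K := pr 2 (pr v K).

(** A frame says what to do with the returned value: [frC] passes it to [f] as argument list, [frA]
    keeps it as the tail and evaluates [g], [frB] conses it onto [vs], [frP] takes the recursion
    step at [x], and [frM] tests whether the search stops at [y]. *)
Definition frC f := pr 0 f.
Definition frA g xs := pr 1 (pr g xs).
Definition frB vs := pr 2 vs.
Definition frP g x xs := pr 3 (pr g (pr x xs)).
Definition frM f xs y := pr 4 (pr f (pr xs y)).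

(** Primitive recursion on the empty list has no evaluation rule, so there the state [z] repeats
    forever. A projection drops one argument per step. *)
Definition eval_step (z o c xs K : nat) : nat :=
  if p1 c == 0 then stR 0 K
  else if p1 c == 1 then stR (p1 xs).+1 K
  else if p1 c == 2 then stR o K
  else if p1 c == 3 then stL (p2 (p2 c)) xs (pr (frC (p1 (p2 c))) K)
  else if p1 c == 4 then
    if xs == 0 then z
    else if p1 xs == 0 then stE (p1 (p2 c)) (p2 xs) K
    else stE c (pr (p1 xs).-1 (p2 xs))
           (pr (frP (p2 (p2 c)) (p1 xs).-1 (p2 xs)) K)
  else if p1 c == 5 then stE (p2 c) (pr 0 xs) (pr (frM (p2 c) xs 0) K)
  else if p2 c == 0 then stR (p1 xs) K
  else stE (pr 6 (p2 c).-1) (p2 xs) K.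

Definition list_step (gs xs K : nat) : nat :=
  if gs == 0 then stR 0 K else stL (p2 gs) xs (pr (frA (p1 gs) xs) K).

Definition ret_step (z v K : nat) : nat :=
  if K == 0 then z
  else if p1 (p1 K) == 0 then stE (p2 (p1 K)) v (p2 K)
  else if p1 (p1 K) == 1 then
    stE (p1 (p2 (p1 K))) (p2 (p2 (p1 K))) (pr (frB v) (p2 K))
  else if p1 (p1 K) == 2 then stR (pr v (p2 (p1 K))) (p2 K)
  else if p1 (p1 K) == 3 then
    stE (p1 (p2 (p1 K)))
      (pr (p1 (p2 (p2 (p1 K)))) (pr v (p2 (p2 (p2 (p1 K)))))) (p2 K)
  else if v == 0 then stR (p2 (p2 (p2 (p1 K)))) (p2 K)
  else stE (p1 (p2 (p1 K)))
    (pr (p2 (p2 (p2 (p1 K)))).+1 (p1 (p2 (p2 (p1 K)))))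
    (pr (frM (p1 (p2 (p1 K))) (p1 (p2 (p2 (p1 K))))
          (p2 (p2 (p2 (p1 K)))).+1) (p2 K)).

(* [o] is the oracle's answer to [query z]. *)
Definition step_ans (z o : nat) : nat :=
  if p1 z == 0 then
    eval_step z o (p1 (p2 z)) (p1 (p2 (p2 z))) (p2 (p2 (p2 z)))
  else if p1 z == 1 then
    list_step (p1 (p2 z)) (p1 (p2 (p2 z))) (p2 (p2 (p2 z)))
  else ret_step z (p1 (p2 z)) (p2 (p2 z)).

(** In an evaluation state this is the head of the argument list, the number [COrc] asks about. *)
Definition query (z : nat) : nat := p1 (p1 (p2 (p2 z))).
Definition step (o : nat -> nat) (z : nat) : nat := step_ans z (o (query z)).
Definition run (o : nat -> nat) (k z : nat) : nat := iter k (step o) z.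

Definition halted (z : nat) : bool := (p1 z == 2) && (p2 (p2 z) == 0).
Definition output (z : nat) : nat := p1 (p2 z).

(* [v.+1] if the code numbered [d] outputs [v] on the list numbered [a] within
   [s] steps, and [0] if it has not halted. *)
Definition reso (o : nat -> nat) (d a s : nat) : nat :=
  if halted (run o s (stE d a 0)) then (output (run o s (stE d a 0))).+1 else 0.

Lemma rec_step_ans A k F G : Rec A k F -> Rec A k G ->
  Rec A k (fun xs => step_ans (F xs) (G xs)).
Proof.
apply: rec_comp2; rewrite /step_ans /eval_step /list_step /ret_step.
by rewrite /stE /stL /stR /frA /frB /frC /frM /frP; rec_auto.
Qed.

(** The oracle may depend on the parameters [xs]: the limit lemma runs the machine on an
    approximation whose stage is one of them. *)
Lemma rec_run A k (O : seq nat -> nat) N Z :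
  Rec A k.+1 O -> Rec A k N -> Rec A k Z ->
  Rec A k (fun xs => run (fun q => O (q :: xs)) (N xs) (Z xs)).
Proof.
move=> hO hN hZ; pose S ys := step_ans (nth 0 ys 0)
  (O (query (nth 0 ys 0) :: behead ys)).
apply: (@rec_iter A k S) => //; apply: rec_step_ans; first exact: rec_proj.
have := @rec_comp A k.+1 O (iota 0 k.+1) (fun j ys =>
  if j is 0 then query (nth 0 ys 0) else nth 0 ys j).
rewrite size_iota => /(_ hO) hC; apply: rec_ext (hC _); last first.
  by rewrite /query => -[|j]; rec_auto.
move=> [|y ys] //= [<-]; congr (O (_ :: _)).
by rewrite (iotaDl 1 0) -map_comp -[RHS](mkseq_nth 0).
Qed.

Lemma rec_reso A k (O : seq nat -> nat) D L S :
  Rec A k.+1 O -> Rec A k D -> Rec A k L -> Rec A k S ->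
  Rec A k (fun xs => reso (fun q => O (q :: xs)) (D xs) (L xs) (S xs)).
Proof.
move=> hO hD hL hS; rewrite /reso /halted /output.
have hrun := rec_run hO hS (rec_pr (rec_const _ _ 0)
  (rec_pr hD (rec_pr hL (rec_const _ _ 0)))).
by rec_auto.
Qed.

(** * Single steps and halting of the machine *)

Section StepEquations.
Variable o : nat -> nat.
Implicit Types (f g : code) (a K : nat).

Let prE := (p1_pr, p2_pr, pr_eq0, p1_nil, p2_nil).

Lemma step_evalE (c a K : nat) :
  step o (stE c a K) = eval_step (stE c a K) (o (p1 a)) c a K.
Proof. by rewrite /step /step_ans /query /stE !prE. Qed.

Lemma step_zero a K : step o (stE (encc CZero) a K) = stR 0 K.
Proof. by rewrite step_evalE /eval_step !prE. Qed.

Lemma step_succ a K : step o (stE (encc CSucc) a K) = stR (p1 a).+1 K.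
Proof. by rewrite step_evalE /eval_step !prE. Qed.

Lemma step_orc a K : step o (stE (encc COrc) a K) = stR (o (p1 a)) K.
Proof. by rewrite step_evalE /eval_step !prE. Qed.

Lemma step_comp f gs a K : step o (stE (encc (CComp f gs)) a K) =
  stL (encl [seq encc g | g <- gs]) a (pr (frC (encc f)) K).
Proof. by rewrite step_evalE /eval_step !prE. Qed.

Lemma step_prec_nil f g K :
  step o (stE (encc (CPrec f g)) 0 K) = stE (encc (CPrec f g)) 0 K.
Proof. by rewrite step_evalE /eval_step !prE. Qed.

Lemma step_prec0 f g a K :
  step o (stE (encc (CPrec f g)) (pr 0 a) K) = stE (encc f) a K.
Proof. by rewrite step_evalE /eval_step !prE. Qed.

Lemma step_precS f g x a K :
  step o (stE (encc (CPrec f g)) (pr x.+1 a) K) =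
  stE (encc (CPrec f g)) (pr x a) (pr (frP (encc g) x a) K).
Proof. by rewrite step_evalE /eval_step !prE. Qed.

Lemma step_mu f a K : step o (stE (encc (CMu f)) a K) =
  stE (encc f) (pr 0 a) (pr (frM (encc f) a 0) K).
Proof. by rewrite step_evalE /eval_step !prE. Qed.

Lemma step_proj0 a K : step o (stE (encc (CProj 0)) a K) = stR (p1 a) K.
Proof. by rewrite step_evalE /eval_step !prE. Qed.

Lemma step_projS i a K :
  step o (stE (encc (CProj i.+1)) a K) = stE (encc (CProj i)) (p2 a) K.
Proof. by rewrite step_evalE /eval_step !prE. Qed.

Lemma step_nil a K : step o (stL 0 a K) = stR 0 K.
Proof. by rewrite /step /step_ans /list_step /stL !prE. Qed.

Lemma step_cons (g l a K : nat) :
  step o (stL (pr g l) a K) = stL l a (pr (frA g a) K).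
Proof. by rewrite /step /step_ans /list_step /stL !prE. Qed.

Lemma step_frC (f v K : nat) : step o (stR v (pr (frC f) K)) = stE f v K.
Proof. by rewrite /step /step_ans /ret_step /stR /frC !prE. Qed.

Lemma step_frA (g a v K : nat) :
  step o (stR v (pr (frA g a) K)) = stE g a (pr (frB v) K).
Proof. by rewrite /step /step_ans /ret_step /stR /frA !prE. Qed.

Lemma step_frB (vs v K : nat) : step o (stR v (pr (frB vs) K)) = stR (pr v vs) K.
Proof. by rewrite /step /step_ans /ret_step /stR /frB !prE. Qed.

Lemma step_frP (g x a v K : nat) :
  step o (stR v (pr (frP g x a) K)) = stE g (pr x (pr v a)) K.
Proof. by rewrite /step /step_ans /ret_step /stR /frP !prE. Qed.

Lemma step_frM0 (f a y K : nat) : step o (stR 0 (pr (frM f a y) K)) = stR y K.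
Proof. by rewrite /step /step_ans /ret_step /stR /frM !prE. Qed.

Lemma step_frMS (f a y v K : nat) : step o (stR v.+1 (pr (frM f a y) K)) =
  stE f (pr y.+1 a) (pr (frM f a y.+1) K).
Proof. by rewrite /step /step_ans /ret_step /stR /frM !prE. Qed.

Lemma halted_E (c a K : nat) : halted (stE c a K) = false.
Proof. by rewrite /halted !prE. Qed.

Lemma halted_L (gs a K : nat) : halted (stL gs a K) = false.
Proof. by rewrite /halted !prE. Qed.

Lemma halted_R v F K : halted (stR v (pr F K)) = false.
Proof. by rewrite /halted !prE. Qed.

Lemma halted_R0 v : halted (stR v 0).
Proof. by rewrite /halted !prE. Qed.

Lemma output_R v K : output (stR v K) = v.
Proof. by rewrite /output !prE. Qed.

Lemma runS k z : run o k.+1 z = run o k (step o z).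
Proof. exact: iterSr. Qed.

Lemma run_add j k z : run o (j + k) z = run o k (run o j z).
Proof. by rewrite /run addnC iterD. Qed.

Lemma halted_run k z : halted z -> run o k z = z.
Proof.
move=> hz; elim: k => //= k ->; move: hz => /andP[/eqP hm /eqP hK].
by rewrite /step /step_ans hm /= /ret_step hK.
Qed.

Lemma reso_halt d a k v s :
  run o k (stE d a 0) = stR v 0 -> k <= s -> reso o d a s = v.+1.
Proof.
move=> hk /subnKC <-; rewrite /reso run_add hk halted_run ?halted_R0 //.
by rewrite output_R.
Qed.

Lemma reso_mono d a s t v :
  s <= t -> reso o d a s = v.+1 -> reso o d a t = v.+1.
Proof.
move=> /subnKC <-; rewrite /reso run_add; case hs: (halted (run o s _)) => // <-.
by rewrite halted_run ?hs.
Qed.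

End StepEquations.

(** * Correctness of the machine *)

Section UniversalMachine.
Variable A : nset.
Let o := chin A.

Lemma p1_encl xs : p1 (encl xs) = nth 0 xs 0.
Proof. by case: xs => // x xs; rewrite encl_cons p1_pr. Qed.

Lemma p2_encl xs : p2 (encl xs) = encl (behead xs).
Proof. by case: xs => // x xs; rewrite encl_cons p2_pr. Qed.

Lemma run_proj i xs K :
  run o i.+1 (stE (encc (CProj i)) (encl xs) K) = stR (nth 0 xs i) K.
Proof.
elim: i xs => [|i IHi] xs; rewrite runS.
  by rewrite step_proj0 p1_encl.
by rewrite step_projS p2_encl IHi nth_behead.
Qed.

(** The number of steps is chosen before the stack [K], so that subcomputations can run on top of
    any pending frames. *)
Lemma machine_complete c xs v : eval A c xs v ->
  exists k, forall K, run o k (stE (encc c) (encl xs) K) = stR v K.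
Proof.
pose P c xs v := exists k, forall K,
  run o k (stE (encc c) (encl xs) K) = stR v K.
pose Q gs xs vs := exists k, forall K,
  run o k (stL (encl [seq encc g | g <- gs]) (encl xs) K) = stR (encl vs) K.
apply: (eval_mut (P := P) (Q := Q)); rewrite /P /Q => {c xs v P Q}.
- by move=> xs; exists 1 => K; rewrite runS step_zero.
- by move=> xs; exists 1 => K; rewrite runS step_succ p1_encl.
- by move=> i xs; exists i.+1 => K; rewrite run_proj.
- move=> xs h; exists 1 => K; rewrite runS step_orc p1_encl /o /chin.
  by rewrite asboolT.
- move=> xs h; exists 1 => K; rewrite runS step_orc p1_encl /o /chin.
  by rewrite asboolF.
- move=> f gs xs ys v [j hj] [k hk]; exists (j + k.+1).+1 => K.
  by rewrite runS step_comp run_add hj runS step_frC hk.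
- move=> f g xs v [k hk]; exists k.+1 => K.
  by rewrite runS encl_cons step_prec0 hk.
- move=> f g x xs w v [j hj] [k hk]; exists (j + k.+1).+1 => K.
  rewrite runS encl_cons step_precS -encl_cons run_add hj runS step_frP.
  by rewrite -!encl_cons hk.
- move=> f xs y [j hj] hlt.
  (* Since the earlier values are positive, the search gets as far as testing each [z <= y]. *)
  have loop z : z <= y -> exists k, forall K, run o k (stE (encc (CMu f)) (encl xs) K)
      = stE (encc f) (encl (z :: xs)) (pr (frM (encc f) (encl xs) z) K).
    elim: z => [|z IHz] hz; first by exists 1 => K; rewrite runS step_mu.
    have [k hk] := IHz (ltnW hz); have [w [l hl]] := hlt z hz.
    exists (k + (l + 1)) => K.
    by rewrite run_add hk run_add hl runS step_frMS.
  have [k hk] := loop y (leqnn y); exists (k + (j + 1)) => K.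
  by rewrite run_add hk run_add hj runS step_frM0.
- by move=> xs; exists 1 => K; rewrite runS step_nil.
- move=> g gs xs v vs [j hj] [k hk]; exists (k + (j + 1).+1).+1 => K.
  by rewrite runS encl_cons step_cons run_add hk runS step_frA run_add hj runS step_frB.
Qed.

Lemma eval_fun c xs v w : eval A c xs v -> eval A c xs w -> v = w.
Proof.
move=> /machine_complete[j hj] /machine_complete[k hk].
have hv := reso_halt (hj 0) (leq_addr k j).
have := reso_halt (hk 0) (leq_addl j k).
by rewrite hv => -[].
Qed.

(* A computation whose result is eventually consumed returns to its own
   stack, after strictly fewer steps. *)
Lemma machine_sound_step k :
  [/\ forall c xs K, halted (run o k (stE (encc c) (encl xs) K)) ->
        exists v j, [/\ j < k, eval A c xs v &
          run o k (stE (encc c) (encl xs) K) = run o j (stR v K)],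
      forall gs xs K, halted (run o k (stL (encl [seq encc g | g <- gs]) (encl xs) K)) ->
        exists vs j, [/\ j < k, evals A gs xs vs &
          run o k (stL (encl [seq encc g | g <- gs]) (encl xs) K)
            = run o j (stR (encl vs) K)] &
      forall f xs y K, (forall z, z < y -> exists w, eval A f (z :: xs) w.+1) ->
        halted (run o k (stE (encc f) (encl (y :: xs))
          (pr (frM (encc f) (encl xs) y) K))) ->
        exists v j, [/\ j < k, eval A (CMu f) xs v &
          run o k (stE (encc f) (encl (y :: xs)) (pr (frM (encc f) (encl xs) y) K))
            = run o j (stR v K)]].
Proof.
elim/ltn_ind: k => -[|k] IH.
  by split=> [c xs K|gs xs K|f xs y K _]; rewrite /= ?halted_E ?halted_L.
have IHE j (lt_jk : j < k.+1) := let: And3 h _ _ := IH j lt_jk in h.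
have IHL j (lt_jk : j < k.+1) := let: And3 _ h _ := IH j lt_jk in h.
have IHM j (lt_jk : j < k.+1) := let: And3 _ _ h := IH j lt_jk in h.
have hE c xs K : halted (run o k.+1 (stE (encc c) (encl xs) K)) ->
    exists v j, [/\ j < k.+1, eval A c xs v &
      run o k.+1 (stE (encc c) (encl xs) K) = run o j (stR v K)].
  case: c => [||i||f gs|f g|f].
  - by rewrite runS step_zero => _; exists 0, k; split=> //; apply: ev_zero.
  - rewrite runS step_succ p1_encl => _; exists (nth 0 xs 0).+1, k.
    by split=> //; apply: ev_succ.
  - have hi := run_proj i xs K.
    case: (leqP i k) => [le_ik|lt_ki].
      move=> _; exists (nth 0 xs i), (k - i); split.
      + by rewrite ltnS leq_subr.
      + exact: ev_proj.
      + by rewrite -{1}(subnKC le_ik) -addSn run_add hi.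
    (* After at most [i] steps the projection is still dropping arguments, hence has not halted. *)
    have -> : run o k.+1 (stE (encc (CProj i)) (encl xs) K)
        = stE (encc (CProj (i - k.+1))) (encl (drop k.+1 xs)) K.
      elim: k.+1 lt_ki => [|m IHm] lt_mi; first by rewrite subn0 drop0.
      rewrite /run iterS -/(run _ _ _) IHm ?(ltnW lt_mi) //.
      by rewrite -(subnSK lt_mi) step_projS p2_encl -drop1 drop_drop.
    by rewrite halted_E.
  - rewrite runS step_orc p1_encl => _; exists (o (nth 0 xs 0)), k.
    by split=> //; apply: eval_orc.
  - rewrite runS step_comp => hh.
    have [vs [j [lt_jk es ej]]] := IHL k (ltnSn k) _ _ _ hh.
    (* With no step left, the run would have halted with a frame still pending. *)
    move: hh; rewrite ej; case: j lt_jk {ej} => [|j] lt_jk.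
      by rewrite /= halted_R.
    rewrite runS step_frC => hh.
    have [v [l [lt_lj e el]]] := IHE j (leqW (ltnW lt_jk)) _ _ _ hh.
    exists v, l; split=> //; last exact: ev_comp es e.
    by rewrite ltnS (leq_trans (ltnW lt_lj)) // ltnW // ltnW.
  - case: xs => [|[|x] xs].
    + have loop m : run o m (stE (encc (CPrec f g)) 0 K) = stE (encc (CPrec f g)) 0 K.
        by elim: m => //= m ->; rewrite step_prec_nil.
      by rewrite (loop k.+1) halted_E.
    + rewrite runS encl_cons step_prec0 => hh.
      have [v [j [lt_jk e ej]]] := IHE k (ltnSn k) _ _ _ hh.
      by exists v, j; split=> //; [apply: ltnW | apply: ev_prec0].
    + rewrite runS encl_cons step_precS -encl_cons => hh.
      have [w [j [lt_jk e ej]]] := IHE k (ltnSn k) _ _ _ hh.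
      move: hh; rewrite ej; case: j lt_jk {ej} => [|j] lt_jk.
        by rewrite /= halted_R.
      rewrite runS step_frP -!encl_cons => hh.
      have [v [l [lt_lj e' el]]] := IHE j (leqW (ltnW lt_jk)) _ _ _ hh.
      exists v, l; split=> //; last exact: ev_precS e e'.
      by rewrite ltnS (leq_trans (ltnW lt_lj)) // ltnW // ltnW.
  - rewrite runS step_mu -encl_cons => hh.
    have [//|v [j [lt_jk e ej]]] := IHM k (ltnSn k) f xs 0 K _ hh.
    by exists v, j; split=> //; apply: ltnW.
split=> // [gs xs K|f xs y K hy hh].
- case: gs => [|g gs].
    by rewrite runS step_nil => _; exists [::], k; split=> //; apply: evs_nil.
  rewrite runS encl_cons step_cons => hh.
  have [vs [j [lt_jk es ej]]] := IHL k (ltnSn k) _ _ _ hh.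
  move: hh; rewrite ej; case: j lt_jk {ej} => [|j] lt_jk.
    by rewrite /= halted_R.
  rewrite runS step_frA => hh.
  have [v [l [lt_lj e el]]] := IHE j (leqW (ltnW lt_jk)) _ _ _ hh.
  move: hh; rewrite el; case: l lt_lj {el} => [|l] lt_lj.
    by rewrite /= halted_R.
  rewrite runS step_frB -encl_cons => _; exists (v :: vs), l.
  split=> //; last exact: evs_cons e es.
  by rewrite ltnS ltnW // (leq_trans (ltnW lt_lj)) // ltnW // ltnW.
- have [v [j [lt_jk e ej]]] := hE _ _ _ hh.
  move: hh; rewrite ej; case: j lt_jk {ej} => [|j] lt_jk.
    by rewrite /= halted_R.
  rewrite runS; case: v e => [|w] e.
    rewrite step_frM0 => _; exists y, j; split=> //; first exact: ltnW.
    exact: ev_mu e hy.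
  rewrite step_frMS -encl_cons => hh.
  (* A positive value at [y] extends the range already searched, and the third clause applies with
     fewer steps left. *)
  have hy' z : z < y.+1 -> exists w, eval A f (z :: xs) w.+1.
    rewrite ltnS leq_eqVlt => /predU1P[->|]; last exact: hy.
    by exists w.
  have [v [l [lt_lj e' el]]] := IHM j (ltnW lt_jk) f xs y.+1 K hy' hh.
  by exists v, l; split=> //; apply: leq_trans lt_lj (ltnW (ltnW lt_jk)).
Qed.

Lemma machine_sound c xs s v :
  reso o (encc c) (encl xs) s = v.+1 -> eval A c xs v.
Proof.
rewrite /reso; case: ifP => // hh [].
have [hE _ _] := machine_sound_step s.
have [w [j [_ e ->]]] := hE _ _ _ hh.
by rewrite halted_run ?halted_R0 // output_R => <-.
Qed.

Lemma reso_complete c xs v : eval A c xs v ->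
  exists s, reso o (encc c) (encl xs) s = v.+1.
Proof.
by move=> /machine_complete[k hk]; exists k; apply: reso_halt (hk 0) (leqnn k).
Qed.

End UniversalMachine.

(** * Decoding the numbering [phi] *)

Definition loop (h : nat -> nat -> nat) (z : nat) : nat :=
  if p1 z == 0 then z else pr (p2 (p1 z)) (h (p1 (p1 z)) (p2 z)).

(** Here [e] rounds suffice: a list is no longer than its code, and [loop] idles once the list is
    exhausted. *)
Definition foldn (h : nat -> nat -> nat) (e z : nat) : nat :=
  p2 (iter e (loop h) (pr e z)).

Lemma size_encl l : size l <= encl l.
Proof.
elim: l => [|x l IHl] //=; rewrite (leq_trans _ (leq_pmull _ _)) ?expn_gt0 //.
by rewrite ltnS (leq_trans IHl) // -addnn leq_addr.
Qed.

Lemma foldn_encl h l z : foldn h (encl l) z = foldl (fun r x => h x r) z l.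
Proof.
rewrite /foldn; suff hm m : size l <= m ->
    iter m (loop h) (pr (encl l) z) = pr 0 (foldl (fun r x => h x r) z l).
  by rewrite hm ?size_encl ?p2_pr.
elim: m l z => [|m IHm] [|x l] z // le_lm; rewrite iterSr.
  by rewrite {2}/loop p1_pr eqxx IHm.
by rewrite encl_cons {2}/loop !(p1_pr, p2_pr) pr_eq0 IHm.
Qed.

Lemma rec_foldn A k h F Z : Rec A 2 (fun ys => h (nth 0 ys 0) (nth 0 ys 1)) ->
  Rec A k F -> Rec A k Z -> Rec A k (fun xs => foldn h (F xs) (Z xs)).
Proof.
move=> hh hF hZ; apply: rec_p2.
pose S ys := loop h (nth 0 ys 0).
apply: (@rec_iter A k S) => //; last exact: rec_pr.
rewrite /S /loop; rec_auto.
by apply: rec_comp2 => //; rec_auto.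
Qed.

(** Follows [tree_code], with [CZero] for ill-formed nodes. For composition, [l] is already the pair
    of head and coded tail that [encc] puts after the tag. *)
Definition code_node (n l : nat) : nat :=
  if n == 0 then pr 0 0
  else if n == 1 then pr 1 0
  else if n == 2 then pr 2 0
  else if (n == 3) && (l != 0) then pr 3 l
  else if [&& n == 4, l != 0 & p2 l != 0] then pr 4 (pr (p1 l) (p1 (p2 l)))
  else if (n == 5) && (l != 0) then pr 5 (p1 l)
  else pr 0 0.

(* Mirrors [GenTree.decode_step] on pickled tokens, building codes instead of
   trees; numbers that are not pickled tokens are skipped. *)
Definition code_step (c z : nat) : nat :=
  if (p2 c == 0) || (p2 (p2 c) != 0) then z
  else if p1 (p2 c) != 0 then pr (pr (pr 6 (p1 (p1 (p2 c)))) (p1 z)) (p2 z)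
  else if p1 c == 0 then z
  else if p1 (p1 c) == 0 then pr 0 (pr (p1 z) (p2 z))
  else pr (pr (code_node (p1 (p1 c)).-1 (p1 z)) (p1 (p2 z))) (p2 (p2 z)).

(** Tree decoding folds from the right, so the inner fold by [pr] first reverses the tokens;
    [pr 0 0] is the pair of empty stacks. *)
Definition code_stacks (e : nat) : nat :=
  p1 (foldn code_step (foldn pr e 0) (pr 0 0)).

(** The default [pr 6 0] codes [CProj 0], which [phi] takes when no tree is decoded. *)
Definition dec (e : nat) : nat :=
  if code_stacks e == 0 then pr 6 0 else p1 (code_stacks e).

Lemma rec_dec A k F : Rec A k F -> Rec A k (fun xs => dec (F xs)).
Proof.
apply: rec_comp1.
have hS : Rec A 1 (fun ys => code_stacks (nth 0 ys 0)).
  rewrite /code_stacks; apply/rec_p1/rec_foldn; last exact: rec_const.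
    by rewrite /code_step /code_node; rec_auto.
  by apply: rec_foldn; rec_auto.
by rewrite /dec; rec_auto.
Qed.

(** A sum is pickled as a pair of options, and an option as a list of at most one entry. Among
    tokens, [inr] is a leaf, [inl 0] closes a node and [inl n.+1] opens one labelled [n]. *)
Lemma unpickle_token c : @unpickle (nat + nat)%type c =
  if CodeSeq.decode c is [:: a; b] then
    if CodeSeq.decode b is x :: _ then Some (inr x)
    else if CodeSeq.decode a is x :: _ then Some (inl x) else None
  else None.
Proof.
rewrite -[LHS]/(obind sum_of_opair (obind (Some \o @pair_of_tag _ _)
  (@unpickle_tagged (option nat) (fun=> option nat) c))) /unpickle_tagged.
case: (CodeSeq.decode c) => [|a [|b [|]]] //=.
by case: (CodeSeq.decode b) => [|x ?] //=; case: (CodeSeq.decode a).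
Qed.

Lemma unpickle_tree e : @unpickle (GenTree.tree nat) e =
  GenTree.decode (pmap (@unpickle (nat + nat)%type) (CodeSeq.decode e)).
Proof. by []. Qed.

Lemma code_nodeE n ts : code_node n (encl [seq encc (tree_code t) | t <- ts]) =
  encc (tree_code (GenTree.Node n ts)).
Proof.
rewrite /code_node; case: n => [|[|[|[|[|[|n]]]]]] //=.
- by case: ts => [|t ts] //=; rewrite pr_eq0 /= -map_comp.
- case: ts => [|t [|u ts]] //=; first by rewrite p2_pr /= andbF.
  by rewrite !pr_eq0 p2_pr pr_eq0 !p1_pr.
- by case: ts => [|t ts] //=; rewrite pr_eq0 p1_pr.
Qed.

Definition enc_trees (ts : seq (GenTree.tree nat)) : nat :=
  encl [seq encc (tree_code t) | t <- ts].
Definition enc_stacks fs : nat :=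
  pr (enc_trees fs.1) (encl [seq enc_trees ts | ts <- fs.2]).

Lemma code_stepE c fs : code_step c (enc_stacks fs) =
  enc_stacks (if unpickle c is Some t then GenTree.decode_step t fs else fs).
Proof.
rewrite unpickle_token -{1}[c]CodeSeq.decodeK /code_step /enc_stacks.
case: (CodeSeq.decode c) => [|a [|b [|d s]]].
- by rewrite p2_nil.
- by rewrite encl_cons p2_pr.
- rewrite !encl_cons !(p1_pr, p2_pr) pr_eq0 /=.
  rewrite -{1 2}[b]CodeSeq.decodeK; case: (CodeSeq.decode b) => [|x s].
    rewrite /= -{1 2 3}[a]CodeSeq.decodeK; case: (CodeSeq.decode a) => [|x s] //=.
    rewrite -/(pr _ _) pr_eq0 p1_pr; case: x => [|n] //=.
    by rewrite code_nodeE; case: fs => [ts [|us fs]] /=; rewrite ?p1_pr ?p2_pr.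
  by rewrite encl_cons pr_eq0 p1_pr.
- by rewrite !encl_cons !p2_pr !pr_eq0.
Qed.

Lemma dec_phi e : dec e = encc (phi e).
Proof.
pose fs := foldr (@GenTree.decode_step nat) ([::], [::])
  (pmap (@unpickle (nat + nat)%type) (CodeSeq.decode e)).
have fsE : code_stacks e = p1 (enc_stacks fs).
  rewrite /code_stacks -{1}[e]CodeSeq.decodeK foldn_encl; congr p1.
  have -> l : foldl (fun r x => pr x r) 0 l = encl (rev l).
    rewrite /rev -[0]/(encl [::]); elim: l [::] => //= x l IHl s.
    by rewrite -encl_cons IHl.
  rewrite foldn_encl foldl_rev /fs; elim: (CodeSeq.decode e) => //= c s ->.
  by rewrite code_stepE; case: (unpickle c).
rewrite /dec fsE /phi unpickle_tree /GenTree.decode /enc_stacks p1_pr -/fs.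
by case: fs {fsE} => [[|t ts] fs] //=; rewrite pr_eq0 p1_pr.
Qed.

Fixpoint code_tree (c : code) : GenTree.tree nat :=
  match c with
  | CZero => GenTree.Node 0 [::]
  | CSucc => GenTree.Node 1 [::]
  | COrc => GenTree.Node 2 [::]
  | CComp f gs => GenTree.Node 3 (code_tree f :: [seq code_tree g | g <- gs])
  | CPrec f g => GenTree.Node 4 [:: code_tree f; code_tree g]
  | CMu f => GenTree.Node 5 [:: code_tree f]
  | CProj i => GenTree.Leaf i
  end.

Lemma code_treeK : cancel code_tree tree_code.
Proof.
(* Codes nest inside lists, so the recursion is made by hand and calls [IH] on the list entries. *)
rewrite /cancel; fix IH 1; case=> [||i||f gs|f g|f] //=; rewrite ?IH //; congr CComp.
by elim: gs => //= g gs ->; rewrite IH.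
Qed.

Lemma phi_surj c : exists e, phi e = c.
Proof. by exists (pickle (code_tree c)); rewrite /phi pickleK /= code_treeK. Qed.

(** * Step-bounded evaluation of [phi] *)

Definition res (A : nset) (e a s : nat) : nat := reso (chin A) (dec e) a s.

Lemma rec_res A k E L S : Rec A k E -> Rec A k L -> Rec A k S ->
  Rec A k (fun xs => res A (E xs) (L xs) (S xs)).
Proof.
move=> hE hL hS; rewrite /res.
apply: (@rec_reso _ _ (fun ys => chin A (nth 0 ys 0))) => //; last exact: rec_dec.
by rec_auto.
Qed.

Lemma res_sound A e xs s v : res A e (encl xs) s = v.+1 -> eval A (phi e) xs v.
Proof. by rewrite /res dec_phi; apply: machine_sound. Qed.

Lemma res_complete A e xs v :
  eval A (phi e) xs v -> exists s, res A e (encl xs) s = v.+1.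
Proof. by rewrite /res dec_phi; apply: reso_complete. Qed.

Lemma res_sound1 A e x s v : res A e (pr x 0) s = v.+1 -> eval A (phi e) [:: x] v.
Proof. by rewrite -[0]/(encl [::]) -encl_cons => /res_sound. Qed.

Lemma res_complete1 A e x v :
  eval A (phi e) [:: x] v -> exists s, res A e (pr x 0) s = v.+1.
Proof. by move=> /res_complete[s hs]; exists s; rewrite -hs encl_cons. Qed.

Lemma res_mono A e a s t v : s <= t -> res A e a s = v.+1 -> res A e a t = v.+1.
Proof. exact: reso_mono. Qed.

(** * The jump *)

(* The argument [p] is hidden in the index as the dummy component [CProj p],
   so that the code can recover it from its input, the index itself. *)
Lemma jump_sigma1 A F : Rec A 2 F -> exists S : nat -> nat,
  (forall B k G, Rec B k G -> Rec B k (fun xs => S (G xs))) /\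
  forall p, jump A (S p) <-> exists b, F [:: b; p] = 0.
Proof.
move=> hF; pose tok := @pickle (nat + nat)%type.
(* Reads [p] off the index, whose third token is that of [GenTree.Leaf p]. *)
pose ext e := p1 (p1 (p2 (p1 (p2 (p2 e))))).
have [f hf] : exists f, forall b e, eval A f [:: b; e] (F [:: b; ext e]).
  have [|f hf] := @rec_comp A 2 F [:: 0; 1] (fun j ys =>
    if j is 0 then nth 0 ys 0 else ext (nth 0 ys 1)) hF.
    by case=> [|j]; rewrite /ext; rec_auto.
  by exists f => b e; apply: (hf [:: b; e]).
(* The tree of [CComp (CProj 1) [:: CProj p; CMu f]], which halts exactly when the search for a zero
   does. Only its third token varies with [p], so its index is computable from [p]. *)
pose tr p := GenTree.Node 3 [:: GenTree.Leaf 1; GenTree.Leaf p; code_tree (CMu f)].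
have [t0 [t1 [r hS]]] : exists t0 t1 r, forall p,
    pickle (tr p) = pr t0 (pr t1 (pr (pr 0 (pr (pr p 0) 0)) r)).
  have tokE p : tok (inr p) = pr 0 (pr (pr p 0) 0) by [].
  have encE p : GenTree.encode (tr p) = [:: inl 4, inr 1, inr p &
      rcons (GenTree.encode (code_tree (CMu f))) (inl 0)].
    by rewrite -[in RHS](cats0 (GenTree.encode _)).
  have pickleE t : pickle t = encl [seq tok u | u <- GenTree.encode t] by [].
  exists (tok (inl 4)), (tok (inr 1)), (encl [seq tok t | t <-
    rcons (GenTree.encode (code_tree (CMu f))) (inl 0)]) => p.
  by rewrite pickleE encE !map_cons !encl_cons tokE.
exists (fun p => pickle (tr p)); split=> [B k G hG | p].
  by apply: rec_ext (fun xs _ => esym (hS (G xs))) _; rec_auto.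
have phi_tr : phi (pickle (tr p)) = CComp (CProj 1) [:: CProj p; CMu f].
  by rewrite /phi pickleK /= code_treeK.
have ext_tr : ext (pickle (tr p)) = p by rewrite hS /ext !(p1_pr, p2_pr).
rewrite /jump phi_tr; split=> [[v ev] | [b hb]].
  inversion_clear ev as [| | | | |? ? ? ys ? es _ | | |].
  inversion_clear es as [|? ? ? ? vs _ es']; inversion_clear es' as [|? ? ? w ? em _].
  inversion_clear em as [| | | | | | | |? ? ? e0 _]; exists w.
  by have := eval_fun e0 (hf _ _); rewrite ext_tr => <-.
have hex : exists b, F [:: b; p] == 0 by exists b; apply/eqP.
have [m /eqP hm min_m] := ex_minnP hex.
have em : eval A (CMu f) [:: pickle (tr p)] m.
  apply: ev_mu => [|z lt_zm]; first by have := hf m (pickle (tr p)); rewrite ext_tr hm.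
  have := hf z (pickle (tr p)); rewrite ext_tr.
  case hz: (F [:: z; p]) => [|w]; last by exists w.
  by have := min_m z; rewrite hz leqNgt lt_zm => /(_ isT).
exists m; apply: ev_comp (evs_cons (ev_proj _ p _) (evs_cons em (evs_nil _ _))) _.
exact: ev_proj.
Qed.

(** The jump decides, for given [a], whether some [b] exists. A failing [a] is then a $\Sigma_1$
    event over the jump, and a second use of [jump_sigma1] decides whether there is one. *)
Lemma rec_pi2 W F : Rec W 2 F ->
  Rec (jump (jump W)) 1 (fun ys =>
    `[< forall a, exists b, F [:: b; pr a (nth 0 ys 0)] = 0 >]).
Proof.
move=> /jump_sigma1[S [recS hS]].
have hG : Rec (jump W) 2 (fun ys => chin (jump W) (S (pr (nth 0 ys 0) (nth 0 ys 1)))).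
  by apply/rec_chin/recS; rec_auto.
have [T [recT hT]] := jump_sigma1 hG.
apply: (@rec_ext _ _ (fun ys => ~~ `[< jump (jump W) (T (nth 0 ys 0)) >])).
  move=> ys _; congr nat_of_bool; apply/negP/asboolP => [h a | h /asboolP/hT[a]].
    apply/hS; apply: contrapT => hn; apply/h/asboolP/hT; exists a.
    by rewrite /= /chin asboolF.
  by rewrite /= /chin asboolT //; apply/hS.
by apply/rec_neg/rec_chin/recT; rec_auto.
Qed.

(** * Turing reductions *)

Lemma turing_leP X Y : turing_le X Y <-> Rec Y 1 (fun ys => chin X (nth 0 ys 0)).
Proof.
split=> [[c hc]|[c hc]].
  exists c => -[|n [|//]] // _; have [v [ev]] := hc n.
  by rewrite /chin /=; case=> -[hX hv]; rewrite hv in ev;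
    [rewrite asboolT | rewrite asboolF].
exists c => n; exists (chin X n); split; first exact: (hc [:: n]).
by rewrite /chin /chi; case: asboolP; [left | right].
Qed.

Fixpoint subst_orc (d c : code) : code :=
  match c with
  | COrc => CComp d [:: CProj 0]
  | CComp f gs => CComp (subst_orc d f) [seq subst_orc d g | g <- gs]
  | CPrec f g => CPrec (subst_orc d f) (subst_orc d g)
  | CMu f => CMu (subst_orc d f)
  | _ => c
  end.

Lemma rec_turing_le X Y k F : turing_le X Y -> Rec X k F -> Rec Y k F.
Proof.
case/turing_leP=> d hd [c hc]; exists (subst_orc d c) => xs /hc {hc}.
pose P c xs v := eval Y (subst_orc d c) xs v.
pose Q cs xs vs := evals Y [seq subst_orc d g | g <- cs] xs vs.
have ho ys : eval Y (CComp d [:: CProj 0]) ys (chin X (nth 0 ys 0)).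
  apply: eval_comp1 (ev_proj _ 0 _) _; exact: (hd [:: nth 0 ys 0]).
apply: (eval_mut (P := P) (Q := Q)); rewrite /P /Q {P Q} /=.
- by move=> ys; apply: ev_zero.
- by move=> ys; apply: ev_succ.
- by move=> i ys; apply: ev_proj.
- by move=> ys h; have := ho ys; rewrite /chin asboolT.
- by move=> ys h; have := ho ys; rewrite /chin asboolF.
- by move=> f gs ys zs v; apply: ev_comp.
- by move=> f g ys v; apply: ev_prec0.
- by move=> f g x ys w v; apply: ev_precS.
- by move=> f ys y; apply: ev_mu.
- by move=> ys; apply: evs_nil.
- by move=> g gs ys v vs; apply: evs_cons.
Qed.

(** * The limit lemma *)

(** The first [k] steps ask finitely many questions, on all of which the approximations are
    eventually right. *)
Lemma run_limit (O : nat -> nat -> nat) o k z :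
  (forall q, exists N, forall s, N <= s -> O s q = o q) ->
  exists N, forall s, N <= s -> run (O s) k z = run o k z.
Proof.
move=> hO; elim: k => [|k [N hN]]; first by exists 0.
have [M hM] := hO (query (run o k z)); exists (maxn M N) => s.
rewrite geq_max => /andP[/hM hs /hN hr].
by rewrite /run !iterS -!/(run _ _ _) hr /step hs.
Qed.

(** At stage [s], the last argument of [G], the jump is approximated by halting within [s] steps,
    and the machine runs [s] steps on that oracle. *)
Lemma limit_lemma Y k F : Rec (jump Y) k F -> exists2 G, Rec Y k.+1 G &
  forall xs, size xs = k -> exists N, forall s, N <= s -> G (rcons xs s) = F xs.
Proof.
case=> c hc; pose O s q : nat := res Y q (pr q 0) s != 0.
(* The predecessor undoes the shift in [reso] and gives 0 while there is no output. *)
pose G ys := (reso (O (nth 0 ys k)) (encc c) (encl [seq nth 0 ys j | j <- iota 0 k])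
  (nth 0 ys k)).-1.
exists G.
  apply/rec_pred/(@rec_reso _ _ (fun ys => res Y (nth 0 ys 0)
    (pr (nth 0 ys 0) 0) (nth 0 ys k.+1) != 0)).
  - by apply/rec_neg/rec_eq; [apply: rec_res | ]; rec_auto.
  - exact: rec_const.
  - by apply: rec_encl => j; exact: rec_proj.
  - exact: rec_proj.
move=> xs sz_xs; have [m hm] := machine_complete (hc xs sz_xs).
have hO q : exists N, forall s, N <= s -> O s q = chin (jump Y) q.
  rewrite /chin; case: asboolP => [[v /res_complete1[N hN]]|hn].
    by exists N => s le_Ns; rewrite /O (res_mono le_Ns hN).
  exists 0 => s _; rewrite /O; case hr: (res _ _ _ _) => [|v] //.
  by case: hn; exists v; apply: res_sound1 hr.
have [N hN] := run_limit m (stE (encc c) (encl xs) 0) hO.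
exists (maxn m N) => s; rewrite geq_max => /andP[le_ms le_Ns].
rewrite /G nth_rcons sz_xs ltnn eqxx.
have -> : [seq nth 0 (rcons xs s) j | j <- iota 0 k] = xs.
  rewrite -[RHS](mkseq_nth 0) sz_xs; apply/eq_in_map => j; rewrite mem_iota /= => lt_jk.
  by rewrite nth_rcons sz_xs lt_jk.
by rewrite (reso_halt (k := m) (v := F xs)) // hN.
Qed.

(** Each use of the limit lemma removes a jump and appends an argument, so the last argument carries
    the innermost limit, which exists everywhere because the functions are total. Entries chosen in
    turn from [A], each beyond the modulus of its limit, realize the value of [F]. *)
Lemma iterated_limit k a F : Rec (jumpn k.+1) a F ->
  exists2 g, Rec emptyset (a + k.+1) g &
  (forall xs, size xs = a + k -> exists v N, forall s, N <= s -> g (rcons xs s) = v) /\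
  forall (A : nset) xs N, infinite_set A -> size xs = a -> exists ss,
    [/\ size ss = k.+1, path ltn N ss, forall s, s \in ss -> A s & g (xs ++ ss) = F xs].
Proof.
elim: k a F => [|k IHk] a F hF; have [G hG limG] := limit_lemma hF.
  exists G; rewrite ?addn1 //; split=> [xs|A xs N hA sz_xs].
    by rewrite addn0 => /limG[N hN]; exists (F xs), N.
  have [M hM] := limG xs sz_xs; have [s [lt_s As]] := hA (maxn M N).
  move: lt_s; rewrite gtn_max => /andP[lt_Ms lt_Ns].
  exists [:: s]; split=> //=; first by rewrite lt_Ns.
    by move=> t; rewrite inE => /eqP->.
  by rewrite cats1 hM // ltnW.
have [g hg [limg cofg]] := IHk _ _ hG.
exists g; first by rewrite -addSnnS.
split=> [xs|A xs N hA sz_xs].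
  by rewrite -addSnnS; apply: limg.
have [M hM] := limG xs sz_xs; have [s [lt_s As]] := hA (maxn M N).
move: lt_s; rewrite gtn_max => /andP[lt_Ms lt_Ns].
have [|ss [sz_ss path_ss Ass gss]] := cofg A (rcons xs s) s hA.
  by rewrite size_rcons sz_xs.
exists (s :: ss); split=> /=; rewrite ?sz_ss ?lt_Ns //.
  by move=> t; rewrite inE => /predU1P[->|/Ass].
by rewrite -cat_rcons gss hM // ltnW.
Qed.

Lemma rec_res_empty A k E L S : Rec A k E -> Rec A k L -> Rec A k S ->
  Rec A k (fun xs => res emptyset (E xs) (L xs) (S xs)).
Proof.
move=> hE hL hS; rewrite /res.
have -> : chin emptyset = fun=> 0.
  by apply: funext => q; rewrite /chin asboolF.
by apply: (@rec_reso _ _ (fun=> 0)) => //; [apply: rec_const | apply: rec_dec].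
Qed.

Ltac rec_hook ::= lazymatch goal with
  | |- Rec ?A _ (fun xs => res ?A (@?E xs) (@?L xs) (@?S xs)) =>
      apply: (rec_res (E := E) (L := L) (S := S))
  | |- Rec _ _ (fun xs => res emptyset (@?E xs) (@?L xs) (@?S xs)) =>
      apply: (rec_res_empty (E := E) (L := L) (S := S))
  end.

(** The shift by one separates a solution 0 from a search that finds nothing below [x]. *)
Definition lsearch (T : nat -> bool) (x : nat) : nat :=
  nat_rect (fun=> nat) 0 (fun q r => if r != 0 then r else if T q then q.+1 else 0) x.

Lemma lsearchE (T : nat -> bool) q x : T q -> (forall r, r < q -> ~~ T r) ->
  q < x -> lsearch T x = q.+1.
Proof.
move=> Tq minq; have low y : y <= q -> lsearch T y = 0.
  by elim: y => //= y IHy lt_yq; rewrite IHy ?(ltnW lt_yq) //= (negbTE (minq y lt_yq)).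
elim: x => // x IHx; rewrite ltnS leq_eqVlt => /predU1P[<-|/IHx hx] /=.
  by rewrite low //= Tq.
by rewrite hx.
Qed.

(** * Diagonalization *)

(* The code [a] of a list, truncated or padded with zeros to length [k]. *)
Definition tup (k a : nat) : seq nat := [seq p1 (iter j p2 a) | j <- iota 0 k].

Lemma tup_encl s : tup (size s) (encl s) = s.
Proof.
rewrite -[RHS](mkseq_nth 0); apply/eq_map => j.
have -> : iter j p2 (encl s) = encl (drop j s).
  by elim: j => [|j IHj] /=; rewrite ?drop0 // IHj p2_encl -drop1 drop_drop.
by rewrite p1_encl nth_drop addn0.
Qed.

(** Brings sortedness into the form of a finite conjunction, which [rec_all] handles. *)
Lemma sorted_map_iota (f : nat -> nat) k :
  sorted ltn [seq f j | j <- iota 0 k.+1] = all (fun j => f j < f j.+1) (iota 0 k).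
Proof.
have path_iota m : path ltn (f m) [seq f j | j <- iota m.+1 k]
    = all (fun j => f j < f j.+1) (iota m k).
  by elim: k m => //= k IHk m; rewrite IHk.
exact: path_iota.
Qed.

(* With [p = (c, i, m)] and [a = (t, s)]: [s] steps do not witness that the
   (k+1)-tuple [t] lies in the set computed by [phi i] from [W] and has color [m] under
   the coloring [t |-> phi c (c :: t)]. *)
Definition thin_upto (W : nset) (k p a : nat) : bool :=
  ~~ [&& res emptyset (p1 p) (pr (p1 p) (encl (tup k.+1 (p1 a)))) (p2 a)
           == (p2 (p2 p)).+1,
         all (fun j => p1 (iter j p2 (p1 a)) < p1 (iter j.+1 p2 (p1 a))) (iota 0 k)
       & all (fun j => res W (p1 (p2 p)) (pr (p1 (iter j p2 (p1 a))) 0) (p2 a) == 2)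
           (iota 0 k.+1)].

(* [forall a, exists b, good W k b a p] says that [phi i] computes from [W] the
   characteristic function of an infinite thin set. *)
Definition good (W : nset) (k b a p : nat) : bool :=
  [&& (res W (p1 (p2 p)) (pr a 0) (p1 b) == 1)
      || (res W (p1 (p2 p)) (pr a 0) (p1 b) == 2),
      a < p1 (p2 b), res W (p1 (p2 p)) (pr (p1 (p2 b)) 0) (p2 (p2 b)) == 2
    & thin_upto W k p a].

(** Negated, with [a] and [p] paired, to match [rec_pi2], where zeros are sought. *)
Lemma rec_good W k : Rec W 2 (fun ys =>
  ~~ good W k (nth 0 ys 0) (p1 (nth 0 ys 1)) (p2 (nth 0 ys 1))).
Proof.
have hi F j : Rec W 2 F -> Rec W 2 (fun ys => iter j p2 (F ys)).
  by move=> hF; elim: j => //= j; apply: rec_p2.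
have ht j : Rec W 2 (fun ys => p1 (iter j p2 (p1 (p1 (nth 0 ys 1))))).
  by apply/rec_p1/hi; rec_auto.
have hts := rec_encl (iota 0 k.+1) ht.
rewrite /good /thin_upto /tup; rec_auto.
- exact: hts.
- by apply: rec_all => j; rec_auto; apply: hi; rec_auto.
- by apply: rec_all => j; rec_auto; apply: hi; rec_auto.
Qed.

(** Results persist at later stages, so the maximum of finitely many halting times serves all
    entries. *)
Lemma sound_all W i (s : seq nat) : (forall x, x \in s -> eval W (phi i) [:: x] 1) ->
  exists N, forall x, x \in s -> forall t, N <= t -> res W i (pr x 0) t = 2.
Proof.
elim: s => [|x s IHs] hs; first by exists 0.
have [|N hN] := IHs; first by move=> y ys; apply: hs; rewrite inE ys orbT.
have [M hM] := res_complete1 (hs x (mem_head x s)).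
exists (maxn M N) => y; rewrite inE => ys t; rewrite geq_max => /andP[le_Mt le_Nt].
by case/predU1P: ys => [->|ys]; [apply: res_mono le_Mt hM | apply: hN].
Qed.

Lemma join_lub_l D Z : turing_le D (join D Z).
Proof.
apply/turing_leP; apply: rec_ext (rec_chin
  (rec_add (rec_proj (join D Z) 1 0) (rec_proj _ _ 0))).
by move=> xs _; rewrite /chin /join addnn odd_double doubleK.
Qed.

Theorem theorem4p8 (n : nat) :
  ~ exists D : nset,
      low2_over D (jumpn n) /\
      forall g : coloring,
        computable_coloring n.+2 g -> stable_coloring n.+1 g ->
        exists A : nset, turing_le A D /\ infinite_set A /\ thin n.+2 g A.
Proof.
case=> D [low2D bndD]; pose W := join D (jumpn n).
pose P p := forall a, exists b, good W n.+1 b a p.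
(* Lowness enters here; the second jump of [jumpn n] is [jumpn n.+2] by conversion. *)
have recP : Rec (jumpn n.+2) 1 (fun ys => `[< P (nth 0 ys 0) >]).
  apply: rec_turing_le low2D _; apply: rec_ext (rec_pi2 (rec_good W n.+1)) => ys _.
  congr nat_of_bool; apply: asbool_equiv_eq.
  split=> h a; have [b hb] := h a; exists b; move: hb; rewrite /= p1_pr p2_pr.
    by case: good.
  by move=> ->.
have [G recG limG] := limit_lemma recP.
pose T c x q := G [:: pr c q; x] == 1.
(* The predecessor undoes the shift in [lsearch], and [p2] takes the color from the pair found. *)
pose M ys := p2 (lsearch (T (nth 0 ys 0) (nth 0 ys 1)) (nth 0 ys 1)).-1.
have recM : Rec (jumpn n.+1) 2 M.
  apply/rec_p2/rec_pred; apply: (rec_prec (S := fun ys => if nth 0 ys 1 != 0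
    then nth 0 ys 1 else if T (nth 0 ys 2) (nth 0 ys 3) (nth 0 ys 0)
    then (nth 0 ys 0).+1 else 0)); rec_auto.
  rewrite /T; apply: rec_eq (rec_const _ _ 1).
  apply: (@rec_comp _ _ G [:: 0; 1] (fun j ys => if j is 0
    then pr (nth 0 ys 2) (nth 0 ys 0) else nth 0 ys 3)) => // -[|j]; rec_auto.
have [g recg [limg cofg]] := iterated_limit recM.
have [cg evg] := recg; have [c phi_c] := phi_surj cg.
have evc s : size s = n.+2 -> eval emptyset (phi c) (c :: s) (g (c :: s)).
  by move=> sz_s; rewrite phi_c; apply: evg; rewrite /= sz_s.
(* A tuple [s] of length [n.+2] consists of the stage [x] and the [n.+1] limit arguments of [g]. *)
have [||A [leAD [infA [m thinA]]]] := bndD (fun s => g (c :: s)).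
- have [d hd] := rec_cons recg (rec_const _ n.+2 c).
  by exists d => s /andP[/eqP sz_s _]; apply: hd.
- move=> sigma /andP[/eqP sz_sigma _].
  have [|v [N hN]] := limg (c :: sigma); first by rewrite /= sz_sigma.
  by exists v, N => s lt_Ns _; apply/hN/ltnW.
have recA : Rec W 1 (fun ys => chin A (nth 0 ys 0)).
  by apply: rec_turing_le (join_lub_l D (jumpn n)) _; apply/turing_leP.
have [i evi] : exists i, forall x, eval W (phi i) [:: x] (chin A x).
  have [d hd] := recA; have [i phi_i] := phi_surj d.
  by exists i => x; rewrite phi_i; apply: (hd [:: x]).
have P_im : P (pr c (pr i m)).
  move=> a; have [s1 hs1] := res_complete1 (evi a).
  have [x [lt_ax Ax]] := infA a; have [s2 hs2] := res_complete1 (evi x).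
  (* [s1] bounds the time to decide [a]; [x] is a member beyond [a], confirmed by time [s2]. *)
  exists (pr s1 (pr x s2)); rewrite /good !(p1_pr, p2_pr).
  rewrite hs1 hs2 lt_ax /chin (asboolT Ax) /=.
  apply/andP; split; first by case: asboolP.
  rewrite /thin_upto !(p1_pr, p2_pr); apply/negP => /and3P[/eqP].
  rewrite -encl_cons => /res_sound hm.
  rewrite -(sorted_map_iota (fun j => p1 (iter j p2 (p1 a)))) => sorted_t /allP At.
  have sz_t : size (tup n.+2 (p1 a)) = n.+2 by rewrite size_map size_iota.
  have := eval_fun (evc _ sz_t) hm.
  apply: thinA; first by rewrite /ktuple sz_t eqxx.
  move=> _ /mapP[j /At/eqP hj ->].
  have := eval_fun (evi _) (res_sound1 hj).
  by rewrite /chin; case: asboolP.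
have exP : exists q, `[< P (pr c q) >] by exists (pr i m); apply/asboolP.
(* Every number [q] is read as the index [p1 q] with the color [p2 q], even 0, which is no value of
   [pr]. *)
have [q /asboolP Pq min_q] := ex_minnP exP.
pose B : nset := fun x => eval W (phi (p1 q)) [:: x] 1.
have infB : infinite_set B.
  move=> N; have [b /and4P[_ lt_N /eqP hb _]] := Pq N.
  exists (p1 (p2 b)); split=> //; move: hb; rewrite p2_pr.
  exact: res_sound1.
have [N hN] : exists N, forall x r, N <= x -> r <= q -> T c x r = `[< P (pr c r) >].
  elim: (q) => [|r [N hN]].
    have [N hN] := limG [:: pr c 0] erefl; exists N => x r le_Nx.
    by rewrite leqn0 => /eqP->; rewrite /T (hN x le_Nx); case: asboolP.
  have [N' hN'] := limG [:: pr c r.+1] erefl; exists (maxn N N') => x r'.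
  rewrite geq_max => /andP[le_Nx le_N'x]; rewrite leq_eqVlt => /predU1P[->|lt_r'].
    by rewrite /T (hN' x le_N'x); case: asboolP.
  exact: hN.
(* Being beyond [q], the search at stage [x] reaches [q]; being beyond [N], its guesses up to [q]
   are right. *)
have [x [lt_x Bx]] := infB (maxn N q).
move: lt_x; rewrite gtn_max => /andP[lt_Nx lt_qx].
have Mx : M [:: c; x] = p2 q.
  rewrite /M /= (@lsearchE _ q) //= ?hN ?(ltnW lt_Nx) //; first exact/asboolP.
  move=> r lt_rq; rewrite hN ?(ltnW lt_Nx) ?(ltnW lt_rq) //; apply/negP => Pr.
  by have := min_q r Pr; rewrite leqNgt lt_rq.
(* Taking the limits along [B] above [x] makes [x :: ss] an increasing tuple from [B] of color
   [p2 q]. *)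
have [ss [sz_ss path_ss Bss gss]] := cofg B [:: c; x] x infB erefl.
have sz_t : size (x :: ss) = n.+2 by rewrite /= sz_ss.
have tE : tup n.+2 (encl (x :: ss)) = x :: ss by rewrite -sz_t tup_encl.
have [N1 hN1] : exists N1, forall y, y \in x :: ss -> forall t, N1 <= t ->
    res W (p1 q) (pr y 0) t = 2.
  by apply: sound_all => y; rewrite inE => /predU1P[->|/Bss].
have [N2 hN2] := res_complete (evc _ sz_t).
(* The stage in this [a] is late enough to witness both the membership of the tuple and its color,
   which [thin_upto] forbids. *)
have [b /and4P[_ _ _]] := Pq (pr (encl (x :: ss)) (maxn N1 N2)).
rewrite /thin_upto !(p1_pr, p2_pr) tE -encl_cons => /negP[].
rewrite (res_mono (leq_maxr N1 N2) hN2) gss Mx eqxx andTb.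
apply/andP; split.
  by rewrite -(sorted_map_iota (fun j => p1 (iter j p2 (encl (x :: ss))))) -/(tup n.+2 _) tE.
apply/allP => j j_lt; apply/eqP/hN1; last exact: leq_maxl.
have := map_f (fun j => p1 (iter j p2 (encl (x :: ss)))) j_lt.
by rewrite -/(tup n.+2 _) tE.
Qed.
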